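(* Let $f(X)=a_{0}+a_{1}X+\cdots +a_{n}X^{n}\in \mathbb{Z}[X]$, $a_{0}a_{n}\neq 0$. Suppose there exist two distinct prime numbers $p$ and $q$, and an index $j\in \{1,\dots ,n-1\}$ which is not a multiple of $n/\gcd(\nu _{q}(a_{n}),n)$, such that (i) $\nu _{p}(a_{0})>0$; $\frac{\nu _{p}(a_{i})}{j-i}>\frac{\nu _{p}(a_{0})}{j}$ for $0<i<j$; $\nu _{p}(a_{j})=0$; $\frac{\nu _{p}(a_{i})}{i-j}>\frac{\nu _{p}(a_{n})}{n-j}$ for $j<i<n$; and $\nu _{p}(a_{n})>0$; (ii) $\nu _{q}(a_{0})=0$; $\frac{\nu _{q}(a_{i})}{i}\geq\frac{\nu _{q}(a_{n})}{n}$ for all $1\le i\le n$; and $\nu _{q}(a_{n})>0$; (iii) $\gcd(\nu _{p}(a_{0}),j)=\gcd(\nu _{p}(a_{n}),n-j)=1$. Then $f$ is irreducible over $\mathbb{Q}$.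
   Context: For a prime $p$ and a nonzero integer $m$, $\nu_p(m)$ is the largest integer $i$ such that $p^i\mid m$; by convention $\nu_p(0)=\infty$ (so lower bounds on $\nu_p(a_i)$ hold automatically when $a_i=0$). *)

(* Defs.v *)
From mathcomp Require Export all_boot all_order all_algebra.
From mathcomp Require Export constructive_ereal.

Set Implicit Arguments.
Unset Strict Implicit.
Unset Printing Implicit Defensive.

Import GRing.Theory Num.Theory.
Local Open Scope ring_scope.

(* For p prime and m != 0, [logn p `|m|] is the exponent of p in m; it is 0
   for m = 0, hence the separate value +oo here.  Codomain \bar rat, because
   valuations get divided by positive integers; there +oo / k%:R%:E = +oo for
   k > 0. *)
Definition nu (p : nat) (m : int) : \bar rat :=
  if m == 0 then +oo%E else (logn p `|m|%N)%:R%:E.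

(* Main.v *)
(* For a prime p and integers A > 0 and B, give the i-th coefficient c of a polynomial the
   weight A v_p(c) + B i.  The indices where this weight is minimal span an edge
   of the Newton polygon, and the ends of the edges of slope -B/A add up under
   multiplication (Dumas).  Across an edge of width d the weights of the two ends
   agree, so A divides B d.

   Let f = g h over Z (Gauss's lemma).  At p the polygon of f has the vertices 0,
   j, n; coprimality of slope numerators and widths makes the left edge of g of
   width 0 or j and its right edge of width 0 or n - j, and convexity makes these
   two edges adjacent.  Hence deg g is one of 0, j, n - j, n.  At q the polygon of
   f is the single edge from 0 to n, so n divides v_q(a_n) deg g, which excludes
   j and n - j. *)
Require Import Defs.
From mathcomp Require Import zify ring.

Set Implicit Arguments.
Unset Strict Implicit.
Unset Printing Implicit Defensive.

Import Order.TTheory GRing.Theory Num.Theory.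
Local Open Scope ring_scope.

(** * Valuations and weights of coefficients *)

Definition vp (p : nat) (c : int) : nat := logn p `|c|.

Lemma pfactor_dvdz (p m : nat) (c : int) :
  prime p -> c != 0 -> ((p ^ m)%:Z %| c)%Z = (m <= vp p c)%N.
Proof. by move=> pp c0; rewrite /vp dvdzE absz_nat pfactor_dvdn // absz_gt0. Qed.

Lemma vpM (p : nat) (b c : int) : b != 0 -> c != 0 ->
  vp p (b * c) = (vp p b + vp p c)%N.
Proof. by move=> b0 c0; rewrite /vp abszM lognM ?absz_gt0. Qed.

Lemma coef_neq0_lt_size (g : {poly int}) i : g`_i != 0 -> (i < size g)%N.
Proof. by move=> gi; rewrite ltnNge; apply: contraNN gi => /(nth_default 0) ->. Qed.

(** Since [vp p 0] is 0 instead of infinity, a weight is meaningful only at a nonzero coefficient;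
    hence the guards below. *)
Definition weight (p A : nat) (B : int) (g : {poly int}) (i : nat) : int :=
  A%:Z * (vp p g`_i)%:Z + B * i%:Z.

(** * Indices of strictly minimal weight and their additivity *)

Definition dominant p A B (g : {poly int}) k :=
  g`_k != 0 /\
  forall i, i != k -> g`_i != 0 -> weight p A B g k < weight p A B g i.

Lemma weightD p A B g h i j :
  weight p A B g i + weight p A B h j =
  A%:Z * (vp p g`_i + vp p h`_j)%N%:Z + B * (i + j)%N%:Z.
Proof. by rewrite /weight !PoszD !mulrDr addrACA. Qed.

Lemma dominant_inj p A B g k l :
  dominant p A B g k -> dominant p A B g l -> k = l.
Proof.
move=> [gk domk] [gl doml]; apply/eqP/negPn/negP => kl.
have lk : l != k by rewrite eq_sym.
by have := lt_trans (domk l lk gl) (doml k kl gk); rewrite ltxx.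
Qed.

(** At index k + l the term g_k h_l alone has the least valuation, so no cancellation can raise it.
    At any other index some product term bounds the weight from below, strictly above the
    minimum. *)
Lemma dominantM p A B g h k l : prime p -> (0 < A)%N ->
  dominant p A B g k -> dominant p A B h l ->
  dominant p A B (g * h) (k + l).
Proof.
move=> pp A0 [gk domk] [hl doml].
have wk i : g`_i != 0 -> weight p A B g k <= weight p A B g i.
  by move=> gi; have [->//|ik] := eqVneq i k; apply/ltW/domk.
have wl i : h`_i != 0 -> weight p A B h l <= weight p A B h i.
  by move=> hi; have [->//|il] := eqVneq i l; apply/ltW/doml.
pose V := (vp p g`_k + vp p h`_l)%N.
have lead : vp p (g * h)`_(k + l) = V /\ (g * h)`_(k + l) != 0.
  have kkl : (k < (k + l).+1)%N by rewrite ltnS leq_addr.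
  have Dc : exists2 c, (g * h)`_(k + l) = g`_k * h`_l + c
                     & ((p ^ V.+1)%:Z %| c)%Z.
    rewrite coefM (bigD1 (Ordinal kkl)) //= addKn; eexists; first by [].
    apply: (big_ind (fun c => ((p ^ V.+1)%:Z %| c)%Z)) => [|x y|i ik].
    - exact: dvdz0.
    - exact: rpredD.
    have [->|gi] := eqVneq g`_i 0; first by rewrite mul0r dvdz0.
    have [->|hi] := eqVneq h`_(k + l - i) 0; first by rewrite mulr0 dvdz0.
    rewrite pfactor_dvdz ?mulf_neq0 // vpM // /V.
    have ik' : i != k :> nat by [].
    (* Both index pairs sum to k + l, so the B terms cancel; dividing by A leaves a strict
       inequality of valuations. *)
    have := ltr_leD (domk i ik' gi) (wl _ hi).
    by rewrite !weightD subnKC -1?ltnS // ltrD2r ltr_pM2l.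
  case: Dc => c Dc dvdc.
  have gh0 : g`_k * h`_l != 0 by rewrite mulf_neq0.
  have ndvd : ~~ ((p ^ V.+1)%:Z %| (g * h)`_(k + l))%Z.
    by rewrite Dc rpredDr // pfactor_dvdz // vpM // ltnn.
  have c0 : (g * h)`_(k + l) != 0.
    by apply: contraNneq ndvd => ->; apply: dvdz0.
  split=> //; apply/eqP; rewrite eqn_leq leqNgt -pfactor_dvdz // ndvd /=.
  rewrite -pfactor_dvdz // Dc rpredD //; first by rewrite pfactor_dvdz // vpM.
  by apply: dvdz_trans dvdc; rewrite dvdzE !absz_nat dvdn_exp2l.
case: lead => lead lead0; split=> // m ml cm.
(* If every nonzero term had larger valuation, one power of p too many would divide the sum. *)
have [i [im gi hi vi]] : exists i, [/\ (i <= m)%N, g`_i != 0, h`_(m - i) != 0 &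
    (vp p g`_i + vp p h`_(m - i) <= vp p (g * h)`_m)%N].
  have [/existsP[i /and3P[gi hi vi]]|no] := boolP [exists i : 'I_m.+1,
      [&& g`_i != 0, h`_(m - i) != 0 &
          (vp p g`_i + vp p h`_(m - i) <= vp p (g * h)`_m)%N]].
    by exists i; split=> //; rewrite -ltnS.
  have : ((p ^ (vp p (g * h)`_m).+1)%:Z %| (g * h)`_m)%Z.
    rewrite {1}coefM; apply: rpred_sum => i _.
    have [->|gi] := eqVneq g`_i 0; first by rewrite mul0r rpred0.
    have [->|hi] := eqVneq h`_(m - i) 0; first by rewrite mulr0 rpred0.
    change ((p ^ (vp p (g * h)`_m).+1)%:Z %| g`_i * h`_(m - i))%Z.
    rewrite pfactor_dvdz ?mulf_neq0 // vpM // ltnNge.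
    by move: no; rewrite negb_exists => /forallP/(_ i); rewrite gi hi.
  by rewrite pfactor_dvdz // ltnn.
rewrite {1}/weight lead -weightD.
(* As m differs from k + l, at least one of the two comparisons is strict. *)
have [ik|ik] := eqVneq i k.
  have il : (m - i)%N != l by lia.
  apply: lt_le_trans (ler_ltD (wk i gi) (doml _ il hi)) _.
  by rewrite weightD subnKC // lerD2r ler_wpM2l.
apply: lt_le_trans (ltr_leD (domk i ik gi) (wl _ hi)) _.
by rewrite weightD subnKC // lerD2r ler_wpM2l.
Qed.

Lemma dominant_exists p A B (g : {poly int}) : g != 0 ->
  (forall i k, g`_i != 0 -> g`_k != 0 ->
     weight p A B g i = weight p A B g k -> i = k) ->
  exists k, dominant p A B g k.
Proof.
move=> g0 inj.
have lg : ((size g).-1 < size g)%N by rewrite prednK ?size_poly_gt0.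
have glead : g`_(Ordinal lg) != 0 by rewrite -lead_coefE lead_coef_eq0.
case: (arg_minP (P := fun i : 'I_(size g) => g`_i != 0)
  (fun i : 'I_(size g) => weight p A B g i) glead) => k gk kmin.
exists k; split=> // i ik gi.
have ig := coef_neq0_lt_size gi.
rewrite lt_neqAle (kmin (Ordinal ig) gi) andbT.
by apply: contra_neq ik => wki; apply/esym/inj.
Qed.

(** * Edges of the Newton polygon and their behaviour under products *)

Definition edge p A B (g : {poly int}) lo hi :=
  [/\ (lo <= hi)%N, g`_lo != 0, g`_hi != 0, weight p A B g lo = weight p A B g hi &
      forall i, g`_i != 0 -> weight p A B g lo <= weight p A B g i /\
        (~~ (lo <= i <= hi)%N -> weight p A B g lo < weight p A B g i)].

Lemma weight_tilt p A B g D e i :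
  weight p (A * D) (B * D%:Z + e) g i = weight p A B g i * D%:Z + e * i%:Z.
Proof. by rewrite /weight PoszM; ring. Qed.

(* Tilting the slope by 1/D, with D above the degree, breaks all ties, so that
   each end of an edge becomes the unique minimum for one of the two tilts. *)
Lemma edgeP p A B (g : {poly int}) lo hi D : (size g <= D)%N ->
  edge p A B g lo hi <->
  dominant p (A * D) (B * D%:Z + 1) g lo /\
  dominant p (A * D) (B * D%:Z - 1) g hi.
Proof.
move=> gD.
have ltD i : g`_i != 0 -> (i < D)%N.
  by move=> gi; apply: leq_trans gD; apply: coef_neq0_lt_size.
split=> [[lohi glo ghi wlohi wmin]|[[glo dlo] [ghi dhi]]].
  have lD := ltD _ glo; have hD := ltD _ ghi.
  (* Between the ends the tilt has the favourable sign; outside, an integer gap of at least 1,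
     scaled by D, outweighs an index difference below D. *)
  split; split=> // i ine gi; rewrite !weight_tilt;
    have [wi swi] := wmin i gi; have iD := ltD i gi;
    have [inn|/swi {wi}] := boolP (lo <= i <= hi)%N; nia.
have lD := ltD _ glo; have hD := ltD _ ghi.
(* The two strict inequalities bound D times the weight difference by less than D in absolute value,
   so the weights agree. *)
have weq : weight p A B g lo = weight p A B g hi.
  have [<-//|lh] := eqVneq lo hi; have hl : hi != lo by rewrite eq_sym.
  by have := dlo hi hl ghi; have := dhi lo lh glo; rewrite !weight_tilt; nia.
have lohi : (lo <= hi)%N.
  have [->//|lh] := eqVneq lo hi.
  by have := dhi lo lh glo; rewrite !weight_tilt weq; lia.
split=> // i gi; have iD := ltD i gi.
have wlo : weight p A B g lo <= weight p A B g i.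
  have [->//|ne] := eqVneq i lo.
  by have := dlo i ne gi; rewrite !weight_tilt; nia.
split=> // out.
have [il|li] := ltnP i lo.
  have ne : i != lo by rewrite ltn_eqF.
  by have := dlo i ne gi; rewrite !weight_tilt; nia.
have ne : i != hi by lia.
by have := dhi i ne gi; rewrite !weight_tilt; nia.
Qed.

Lemma size_poly_mulN0 (g h : {poly int}) : g * h != 0 ->
  [/\ g != 0, h != 0 & (size g + size h = (size (g * h)%R).+1)%N].
Proof.
rewrite mulf_eq0 negb_or => /andP[g0 h0]; split=> //.
by rewrite size_mul // prednK // addn_gt0 size_poly_gt0 g0.
Qed.

(** For either tilt the dominant indices of g and h add up to a dominant index of the product, which
    is unique and therefore the given end. An edge of a factor may shrink to a vertex, with equal
    ends. *)
Lemma edge_factor p A B g h lo hi : prime p -> (0 < A)%N ->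
  edge p A B (g * h) lo hi ->
  exists l1 h1 l2 h2, [/\ (l1 + l2 = lo)%N, (h1 + h2 = hi)%N,
    edge p A B g l1 h1 & edge p A B h l2 h2].
Proof.
move=> pp A0 Ef; pose D := size (g * h).
have f0 : g * h != 0.
  by case: Ef => _ flo _ _ _; apply: contraNneq flo => ->; rewrite coef0.
have [g0 h0 sz] := size_poly_mulN0 f0.
have D0 : (0 < D)%N by rewrite size_poly_gt0.
(* A tie of tilted weights would make D divide an index difference smaller than D. *)
have tilted (e : int) : `|e| = 1 -> forall f : {poly int}, f != 0 -> (size f <= D)%N ->
    exists k, dominant p (A * D) (B * D%:Z + e) f k.
  move=> e1 f f_neq0 fD; apply: dominant_exists => // i k fi fk.
  have ltD i' : f`_i' != 0 -> (i' < D)%N.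
    by move=> fi'; apply: leq_trans fD; apply: coef_neq0_lt_size.
  have := ltD i fi; have := ltD k fk; rewrite !weight_tilt.
  have [->|->] : e = 1 \/ e = -1 by lia.
    by case: (ltgtP (weight p A B f i) (weight p A B f k)) => [||->]; nia.
  by case: (ltgtP (weight p A B f i) (weight p A B f k)) => [||->]; nia.
have gD : (size g <= D)%N by have := h0; rewrite -size_poly_gt0; lia.
have hD : (size h <= D)%N by have := g0; rewrite -size_poly_gt0; lia.
have [dlo dhi] := (edgeP p A B lo hi (leqnn D)).1 Ef.
have AD0 : (0 < A * D)%N by rewrite muln_gt0 A0.
have [l1 dl1] := tilted 1 erefl g g0 gD.
have [l2 dl2] := tilted 1 erefl h h0 hD.
have [h1 dh1] := tilted (-1) erefl g g0 gD.
have [h2 dh2] := tilted (-1) erefl h h0 hD.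
have lE := dominant_inj (dominantM pp AD0 dl1 dl2) dlo.
have hE := dominant_inj (dominantM pp AD0 dh1 dh2) dhi.
exists l1, h1, l2, h2; split=> //; last exact/(edgeP p A B l2 h2 hD).
exact/(edgeP p A B l1 h1 gD).
Qed.

(** * Bounds on valuations and the geometry of edges *)

Lemma nu0 p m : nu p m = 0%E -> m != 0 /\ vp p m = 0%N.
Proof. by rewrite /nu; case: eqVneq => // _ [/eqP]; rewrite pnatr_eq0 => /eqP. Qed.

Lemma nu_div_le p (b c : int) k l : (0 < k)%N -> (0 < l)%N -> c != 0 ->
  (nu p b / (k%:R)%:E <= nu p c / (l%:R)%:E)%E -> (vp p b * l <= vp p c * k)%N.
Proof.
move=> k0 l0 c0; rewrite /nu (negPf c0).
have k0' : (k%:R != 0 :> rat) by rewrite pnatr_eq0 -lt0n.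
have l0' : (l%:R != 0 :> rat) by rewrite pnatr_eq0 -lt0n.
case: eqVneq => [->|b0]; first by rewrite /vp absz0 logn0.
rewrite !inver (negPf k0') (negPf l0') -!EFinM lee_fin.
by rewrite ler_pdivrMr ?ltr0n // mulrAC ler_pdivlMr ?ltr0n // -!natrM ler_nat.
Qed.

(** Convexity: the first edge falls and the second rises. Were e' < e, minimality on the first would
    give a smaller valuation at e than at e', and on the second the reverse. *)
Lemma edges_ordered p A A' (U W : nat) g l e e' h :
  (0 < A)%N -> (0 < A')%N -> (0 < U)%N -> (0 < W)%N ->
  edge p A U%:Z g l e -> edge p A' (- W%:Z) g e' h -> (e <= e')%N.
Proof.
move=> A0 A'0 U0 W0 [_ _ ge wle left_min] [_ ge' _ _ right_min].
have := (left_min _ ge').1; have := (right_min _ ge).1; rewrite wle /weight.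
set x := vp p g`_e; set y := vp p g`_e' => yx xy.
rewrite leqNgt; apply/negP => e'e.
have : (x < y)%N by nia.
have : (y < x)%N by nia.
lia.
Qed.

Lemma edge_width p A (B : int) g l h :
  edge p A B g l h -> (A %| `|B|%N * (h - l))%N.
Proof.
case=> lh _ _ w _; have -> : (`|B| * (h - l))%N = `|(B * (h - l)%N%:Z)%R|%N.
  by rewrite abszM.
have : B * (h - l)%N%:Z = A%:Z * ((vp p g`_l)%:Z - (vp p g`_h)%:Z).
  by move: w; rewrite /weight -subzn //; lia.
by move=> ->; rewrite abszM absz_nat dvdn_mulr.
Qed.

(** Both ends have weight j v_p(f_0). Between them the slope bounds apply; beyond j the term
    v_p(f_0) i alone exceeds this weight. *)
Lemma edge_descending p (f : {poly int}) j : (0 < j)%N ->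
  f`_0 != 0 -> (0 < vp p f`_0)%N -> f`_j != 0 -> vp p f`_j = 0 ->
  (forall i, (0 < i < j)%N -> f`_i != 0 ->
     (vp p f`_0 * (j - i) <= vp p f`_i * j)%N) ->
  edge p j (vp p f`_0)%:Z f 0 j.
Proof.
move=> j0 f0 U0 fj vj below; split=> //.
  by rewrite /weight vj; lia.
move=> i fi; rewrite /weight; have := below i; rewrite fi => /(_ _ isT).
have [->|i0] := posnP i; first by rewrite leq0n.
move: (vp p f`_0) (vp p f`_i) U0 => U v U0 {below}.
have [ij|ji] := ltnP i j.
  move=> /(_ isT); rewrite leq0n (ltnW ij) mulnBr => Uv; split=> //.
  by have : (U * i <= U * j)%N; [rewrite leq_mul2l ltnW ?orbT | lia].
have := leq_mul (leqnn U) ji; split=> [|out]; first by lia.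
by have : (U * j < U * i)%N; [rewrite ltn_pmul2l //; lia | lia].
Qed.

(** Both ends have weight -v_p(f_n) j, which -v_p(f_n) i alone exceeds for i < j; the size bound
    excludes i > n. Taking j = 0 gives the single edge at q. *)
Lemma edge_ascending p (f : {poly int}) j n : (j < n)%N -> (size f <= n.+1)%N ->
  f`_j != 0 -> vp p f`_j = 0 -> f`_n != 0 -> (0 < vp p f`_n)%N ->
  (forall i, (j < i < n)%N -> f`_i != 0 ->
     (vp p f`_n * (i - j) <= vp p f`_i * (n - j))%N) ->
  edge p (n - j) (- (vp p f`_n)%:Z) f j n.
Proof.
move=> jn szf fj vj fn W0 above; split=> //; first exact: ltnW.
  by rewrite /weight vj -subzn ?(ltnW jn) //; ring.
move=> i fi; rewrite /weight vj; have := above i; rewrite fi => /(_ _ isT).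
have iN : (i <= n)%N.
  by rewrite -ltnS; apply: leq_trans szf; apply: coef_neq0_lt_size.
move: W0; have [->|iN'] := eqVneq i n.
  by rewrite leqnn (ltnW jn) -subzn ?(ltnW jn) // => _ _; split=> //; lia.
move: (vp p f`_n) (vp p f`_i) => W v W0 {above}.
set m := (n - j)%N; have [ji|ij] := ltnP j i.
  have -> : (i < n)%N by rewrite ltn_neqAle iN' iN.
  move=> /(_ isT); rewrite iN (ltnW ji) mulnBr => Wv; split=> //.
  by have := leq_mul (leqnn W) (ltnW ji); lia.
have := leq_mul (leqnn W) ij; split=> [|out]; first by lia.
by have : (W * i < W * j)%N; [rewrite ltn_pmul2l //; lia | lia].
Qed.

(** * Possible degrees of a factor *)

Lemma dvdn_div_gcd (V n j : nat) : (0 < n)%N ->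
  (n %| V * j)%N -> (n %/ gcdn V n %| j)%N.
Proof.
move=> n0 nVj; have G0 : (0 < gcdn V n)%N by rewrite gcdn_gt0 n0 orbT.
rewrite -(@Gauss_dvdr _ (V %/ gcdn V n)).
  rewrite -(dvdn_pmul2l G0) mulnA ![(gcdn V n * _)%N]mulnC.
  by rewrite !divnK ?dvdn_gcdl ?dvdn_gcdr.
rewrite coprime_sym /coprime -(eqn_pmul2r G0) muln_gcdl.
by rewrite !divnK ?dvdn_gcdl ?dvdn_gcdr // mul1n.
Qed.

Lemma edge_lt_size p A B (g : {poly int}) lo hi :
  edge p A B g lo hi -> (hi < size g)%N.
Proof. by case=> _ _ ghi _ _; apply: coef_neq0_lt_size. Qed.

Lemma edges_factor_size (p q n j U W V : nat) (g h : {poly int}) :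
  prime p -> prime q -> (0 < j)%N -> (j < n)%N -> size (g * h) = n.+1 ->
  (0 < U)%N -> (0 < W)%N -> coprime j U -> coprime (n - j) W ->
  ~~ (n %| V * j)%N ->
  edge p j U%:Z (g * h) 0 j -> edge p (n - j) (- W%:Z) (g * h) j n ->
  edge q n (- V%:Z) (g * h) 0 n ->
  size g = 1%N \/ size g = n.+1.
Proof.
move=> pp qp j0 jn sz_gh U0 W0 cU cW nVj left_edge right_edge q_edge.
have gh0 : g * h != 0 by rewrite -size_poly_gt0 sz_gh.
have [g0 h0 sz] := size_poly_mulN0 gh0; rewrite sz_gh in sz.
rewrite -size_poly_gt0 in g0; rewrite -size_poly_gt0 in h0.
have nj0 : (0 < n - j)%N by rewrite subn_gt0.
have n0 : (0 < n)%N by apply: leq_trans jn.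
have [l1 [e1 [l2 [e2 [l12 e12 L1 L2]]]]] := edge_factor pp j0 left_edge.
have [s1 [d1 [s2 [d2 [s12 d12 R1 R2]]]]] := edge_factor pp nj0 right_edge.
have [k1 [m1 [k2 [m2 [k12 m12 Q1 Q2]]]]] := edge_factor qp n0 q_edge.
have es1 := edges_ordered j0 nj0 U0 W0 L1 R1.
have es2 := edges_ordered j0 nj0 U0 W0 L2 R2.
have d1g := edge_lt_size R1; have d2h := edge_lt_size R2.
have m1g := edge_lt_size Q1; have m2h := edge_lt_size Q2.
have [sd1 _ _ _ _] := R1; have [sd2 _ _ _ _] := R2.
have := edge_width L1; have := edge_width R1; have := edge_width Q1.
rewrite !abszN !absz_nat (Gauss_dvdr _ cU) (Gauss_dvdr _ cW).
clear -d1g d2h m1g m2h sd1 sd2 sz g0 h0 jn j0 nVj l12 e12 s12 d12 k12 m12 es1 es2.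
(* The upper ends sum to n and the sizes to n + 2, so each upper end is the degree of its factor.
   Lower ends summing to 0 vanish. *)
have -> : m1 = (size g).-1 by lia.
have -> : d1 = (size g).-1 by lia.
have -> : k1 = 0%N by lia.
have -> : l1 = 0%N by lia.
(* Here e1 <= s1 and e2 <= s2 while both sums are j, so the two edges of g meet. *)
have -> : s1 = e1 by lia.
rewrite !subn0 => qdvd /dvdnP[x xE] /dvdnP[y yE].
(* The edges of g are no wider than those of the product, j and n - j, so both multiples are 0 or
   1. *)
have y01 : y = 0%N \/ y = 1%N by clear -yE e12 j0; nia.
have x01 : x = 0%N \/ x = 1%N.
  have : (x * (n - j) <= n - j)%N by lia.
  by clear -jn; nia.
case: x01 y01 xE yE => -> [] ->; rewrite ?mul0n ?mul1n => xE yE.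
- by left; lia.
- by case/negP: nVj; move: qdvd; have -> : (size g).-1 = j by lia.
- move: qdvd; have -> : (size g).-1 = (n - j)%N by lia.
  (* As n divides both V n - V j and V n, it divides V j. *)
  rewrite mulnBr => qdvd; case/negP: nVj.
  by rewrite -(dvdn_subr _ (dvdn_mull V (dvdnn n))) // leq_mul2l (ltnW jn) orbT.
- by right; lia.
Qed.

(* The three edges of f and its irreducibility *)
Local Close Scope ring_scope.

Theorem theorem1p3 (n : nat) (a : nat -> int) (f : {poly int})
    (f_def : f = (\poly_(i < n.+1) a i)%R)
    (a0an_neq0 : (a 0%N * a n != 0)%R)
    (p q : nat) (p_prime : prime p) (q_prime : prime q) (pq_neq : p != q)
    (j : nat) (j_range : 1 <= j <= n - 1)
    (j_not_multiple : ~~ (n %/ gcdn (logn q `|a n|) n %| j))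
    (i_a0 : (0 < nu p (a 0%N))%E)
    (i_left : forall i : nat, 0 < i < j ->
      (nu p (a 0%N) / (j%:R)%:E < nu p (a i) / ((j - i)%:R)%:E)%E)
    (i_aj : nu p (a j) = 0%E)
    (i_right : forall i : nat, j < i < n ->
      (nu p (a n) / ((n - j)%:R)%:E < nu p (a i) / ((i - j)%:R)%:E)%E)
    (i_an : (0 < nu p (a n))%E)
    (ii_a0 : nu q (a 0%N) = 0%E)
    (ii_slopes : forall i : nat, 1 <= i <= n ->
      (nu q (a n) / (n%:R)%:E <= nu q (a i) / (i%:R)%:E)%E)
    (ii_an : (0 < nu q (a n))%E)
    (iii_left : gcdn (logn p `|a 0%N|) j = 1)
    (iii_right : gcdn (logn p `|a n|) (n - j) = 1) :
  irreducible_poly (map_poly (intr : int -> rat) f).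
Proof.
case/andP: j_range => j1 jn_1.
have jn : j < n by rewrite -(prednK (leq_trans j1 (leq_trans jn_1 (leq_subr 1 n)))) -subn1.
have n0 : 0 < n by apply: leq_trans jn.
move: a0an_neq0; rewrite mulf_eq0 negb_or => /andP[a0 an].
have [aj vaj] := nu0 i_aj; have [_ va0] := nu0 ii_a0.
have U0 : 0 < vp p (a 0) by move: i_a0; rewrite /nu (negPf a0) lte_fin ltr0n.
have W0 : 0 < vp p (a n) by move: i_an; rewrite /nu (negPf an) lte_fin ltr0n.
have V0 : 0 < vp q (a n) by move: ii_an; rewrite /nu (negPf an) lte_fin ltr0n.
have fE i : i <= n -> (f`_i)%R = a i by rewrite f_def coef_poly ltnS => ->.
have f0E : (f`_0)%R = a 0 by apply: fE.
have fjE : (f`_j)%R = a j by apply/fE/ltnW.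
have fnE : (f`_n)%R = a n by apply: fE.
have sz_f : size f = n.+1 by rewrite f_def size_poly_eq.
have left_edge : edge p j (vp p (a 0))%:Z f 0 j.
  rewrite -f0E; apply: edge_descending; rewrite ?f0E ?fjE // => i ij.
  have [i0 lt_ij] := andP ij; rewrite fE; last exact/ltnW/(ltn_trans lt_ij).
  by move=> ai; apply: nu_div_le (ltW (i_left i ij)); rewrite // subn_gt0.
have right_edge : edge p (n - j) (- (vp p (a n))%:Z)%R f j n.
  rewrite -fnE; apply: edge_ascending; rewrite ?fnE ?fjE ?sz_f // => i ij.
  have [lt_ji lt_in] := andP ij; rewrite fE; last exact: ltnW.
  by move=> ai; apply: nu_div_le (ltW (i_right i ij)); rewrite // subn_gt0.
have q_edge : edge q n (- (vp q (a n))%:Z)%R f 0 n.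
  (* Writing the first parameter as n - 0 exhibits the ascending edge that starts at index 0. *)
  rewrite -fnE -[X in edge _ X]subn0.
  apply: edge_ascending; rewrite ?fnE ?f0E ?sz_f // => i /andP[i0 lt_in].
  have lein := ltnW lt_in; rewrite fE // !subn0 => ai.
  by apply: nu_div_le (ii_slopes i _); rewrite ?i0.
split=> [|r sz_r dvd_r]; first by rewrite size_rat_int_poly sz_f.
(* Gauss's lemma: the rational divisor r is a scalar multiple of an integer divisor g of f. *)
have [g [c c0 rE] [h fgh]] := dvdpP_rat_int dvd_r.
have sz_rg : size r = size g by rewrite rE size_scale // size_rat_int_poly.
(* A divisor of the same size is an associate, so only the size of g remains to be found. *)
rewrite -(dvdp_size_eqp dvd_r) size_rat_int_poly sz_rg sz_f.
rewrite fgh in left_edge right_edge q_edge sz_f.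
have nVj : ~~ (n %| vp q (a n) * j).
  by apply: contra j_not_multiple; apply: dvdn_div_gcd.
have cU : coprime j (vp p (a 0)) by rewrite /coprime gcdnC iii_left.
have cW : coprime (n - j) (vp p (a n)) by rewrite /coprime gcdnC iii_right.
have [sz_g|->//] := edges_factor_size p_prime q_prime j1 jn sz_f U0 W0 cU cW nVj
  left_edge right_edge q_edge.
by rewrite sz_rg sz_g in sz_r.
Qed.
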